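(* Let $p$ be a prime with $p\equiv\pm1\pmod{12}$. Then $$\sum_{k=0}^{p-1}\binom{p-1}{k}\binom{2k}{k}(-1)^k u_k(4,1)\equiv(-1)^{(p-1)/2}u_{p-1}(4,1)\pmod{p^3}.$$
   Context: For integers $A,B$, the Lucas sequence $u_n=u_n(A,B)$ ($n\in\mathbb N$) is defined by $u_0=0$, $u_1=1$, and $u_{n+1}=Au_n-Bu_{n-1}$ for $n\ge1$. *)

(* Defs.v *)
From mathcomp Require Import all_boot all_order all_algebra.

Set Implicit Arguments.
Unset Strict Implicit.
Unset Printing Implicit Defensive.

Import Order.TTheory GRing.Theory Num.Theory.
Local Open Scope ring_scope.

Fixpoint lucas (A B : int) (n : nat) {struct n} : int :=
  match n with
  | 0%N => 0
  | 1%N => 1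
  | (m.+1 as n').+1 => A * lucas A B n' - B * lucas A B m
  end.

(* Main.v *)
(** Put n = p - 1. Let z be a primitive 12th root of unity and s = z + 1/z, so
    that s^2 = 3 and the roots of x^2 - 4 x + 1 are a = 2 + s and b = 2 - s.
    For any c the sum of C(n,k) C(2k,k) c^k is the coefficient of X^n in
    (X + c (X + 1)^2)^n. For c = -a this base factors as -a (X + z) (X + 1/z),
    for c = -b as -b (X - z) (X - 1/z); n being even, both coefficients are
    multiples of the same T = sum C(n,k)^2 z^(n-2k), and the sum of the theorem
    is exactly u_n T. As C(n,k) = (-1)^k mod p, squaring the difference gives
    C(n,k)^2 = 2 (-1)^k C(n,k) - 1 mod p^2, so that T is congruent mod p^2 to
    2 (z - 1/z)^n - (z^p - z^-p) / (z - 1/z) = (-1)^(n/2), since z - 1/z = z^3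
    and z^p is z or 1/z. Finally p divides u_n, because Frobenius fixes s, hence
    a and b, modulo p. Congruences are taken in the ring of algebraic integers:
    x = y mod m is expressed as [(x - y) / m \in Aint]. *)

Require Import Defs.
From mathcomp Require Import all_boot all_order all_algebra all_field.
From mathcomp Require Import ring zify.

Set Implicit Arguments.
Unset Strict Implicit.
Unset Printing Implicit Defensive.

Import GRing.Theory Num.Theory.
Local Open Scope ring_scope.

(** * Coefficients of powers of quadratics *)

Lemma coef_exp_XaddC (R : comNzRingType) (a : R) n k :
  (('X + a%:P) ^+ n)`_k = a ^+ (n - k) *+ 'C(n, k).
Proof.
rewrite addrC exprDn coef_sum.
under eq_bigr do rewrite -rmorphXn coefMn mul_polyC coefZ coefXn.
have [le_kn|lt_nk] := leqP k n; last first.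
  rewrite bin_small // mulr0n big1 // => i _.
  by rewrite gtn_eqF ?mulr0 ?mul0rn // (leq_ltn_trans _ lt_nk) // -ltnS.
rewrite (bigD1 (Ordinal (le_kn : k < n.+1)%N)) //= eqxx mulr1 big1 ?addr0 //.
move=> i /negPf ne_ik; rewrite eq_sym; move: ne_ik; rewrite -val_eqE /= => ->.
by rewrite mulr0 mul0rn.
Qed.

(** In the binomial expansion, X^(n-k) (X+1)^(2k) contributes its coefficient at X^n, that is
    C(2k,k). *)
Lemma coef_central_shift (R : comNzRingType) (c : R) n :
  (('X + c *: ('X + 1) ^+ 2) ^+ n)`_n =
  \sum_(k < n.+1) c ^+ k *+ ('C(n, k) * 'C(2 * k, k)).
Proof.
rewrite exprDn coef_sum; apply: eq_bigr => -[k /= le_kn] _.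
rewrite coefMn exprZn -exprM -scalerAr coefZ coefXnM ltnNge leq_subr /=.
rewrite subKn // -polyC1 coef_exp_XaddC expr1n.
by rewrite mulr_natr -mulrnA mulnC.
Qed.

Lemma coef_central_factored (R : comNzRingType) (a b : R) n :
  ((('X + a%:P) * ('X + b%:P)) ^+ n)`_n =
  \sum_(k < n.+1) (a ^+ (n - k) * b ^+ k) *+ 'C(n, k) ^ 2.
Proof.
rewrite exprMn coefM; apply: eq_bigr => -[k /= le_kn] _.
by rewrite !coef_exp_XaddC bin_sub // subKn // mulrnAl mulrnAr -mulrnA mulnn.
Qed.

(** Induction by Pascal's rule: two neighbours C(p-1,k) and C(p-1,k+1) add up to C(p,k+1), a
    multiple of p. *)
Lemma prime_dvd_bin_pred (p k : nat) : prime p -> (k < p)%N ->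
  (p%:Z %| 'C(p.-1, k)%:Z - (-1) ^+ k)%Z.
Proof.
move=> pr_p; elim: k => [|k IHk] lt_kp; first by rewrite bin0 subrr dvdz0.
have: (p%:Z %| 'C(p, k.+1)%:Z)%Z by apply: prime_dvd_bin.
rewrite -[X in 'C(X, _)](prednK (prime_gt0 pr_p)) binS PoszD => dvd_C.
have -> : 'C(p.-1, k.+1)%:Z - (-1) ^+ k.+1 =
  'C(p.-1, k.+1)%:Z + 'C(p.-1, k)%:Z - ('C(p.-1, k)%:Z - (-1) ^+ k).
  by rewrite exprS; ring.
by rewrite rpredB // IHk // ltnW.
Qed.

Lemma prime_dvd_bin_pred_sqr (p k : nat) : prime p -> (k < p)%N ->
  (p%:Z ^+ 2 %| ('C(p.-1, k) ^ 2)%:Z - (2 * (-1) ^+ k * 'C(p.-1, k)%:Z - 1))%Z.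
Proof.
move=> pr_p lt_kp; have /dvdzP[q Eq] := prime_dvd_bin_pred pr_p lt_kp.
apply/dvdzP; exists (q ^+ 2); rewrite -exprMn -Eq -mulnn PoszM.
have: (-1) ^+ k * (-1) ^+ k = 1 :> int by rewrite -expr2 sqrr_sign.
move: ((-1) ^+ k) => e e2; apply: subr0_eq.
by transitivity (1 - e * e); [ring | rewrite e2 subrr].
Qed.

(** A rational algebraic integer is an integer; this brings congruences back from [Aint] to the
    integers. *)
Lemma dvdz_Aint (d m : int) : d != 0 ->
  (m%:~R / d%:~R : algC) \in Aint -> (d %| m)%Z.
Proof.
move=> d_neq0 Aq; have /intrP[k Ek] : (m%:~R / d%:~R : algC) \in Num.int.
  by apply: Cint_rat_Aint Aq; rewrite rpred_div ?rpred_int.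
apply/dvdzP; exists k; apply: (@intr_inj algC); rewrite rmorphM /= -Ek divfK //.
by rewrite intr_eq0.
Qed.

Lemma Aint_dvdz (d m : int) : d != 0 -> (d %| m)%Z ->
  (m%:~R / d%:~R : algC) \in Aint.
Proof.
move=> d_neq0 /dvdzP[k ->]; rewrite rmorphM /= mulfK ?intr_eq0 //.
exact: Aint_int.
Qed.

Lemma Frobenius_Aint (p : nat) (x y : algC) : prime p ->
  x \in Aint -> y \in Aint ->
  ((x + y) ^+ p - (x ^+ p + y ^+ p)) / p%:R \in Aint.
Proof.
move=> pr_p Ax Ay; have p_gt0 := prime_gt0 pr_p.
rewrite exprDn -(prednK p_gt0) big_ord_recl big_ord_recr /= /bump /= add1n.
rewrite prednK // subn0 subnn !expr0 bin0 binn mulr1 mul1r !mulr1n.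
have -> (a b c : algC) : a + (b + c) - (a + c) = b by ring.
rewrite mulr_suml rpred_sum // => i _.
rewrite -[_ *+ _]mulr_natr -(mulrA _ _ p%:R^-1).
apply: rpredM; first by rewrite rpredM ?rpredX.
apply: (@Aint_dvdz p%:Z _%:Z); first by rewrite eqz_nat -lt0n.
by apply: prime_dvd_bin => //; case: i => i /=; rewrite /bump; lia.
Qed.

(** Binet's formula cleared of its denominator, hence valid in any commutative ring. *)
Lemma lucas_Binet (R : comNzRingType) (A B : int) (a b : R) k :
  a + b = A%:~R -> a * b = B%:~R ->
  (a - b) * (lucas A B k)%:~R = a ^+ k - b ^+ k.
Proof.
move=> Eab Mab; suff []: (a - b) * (lucas A B k)%:~R = a ^+ k - b ^+ k /\
  (a - b) * (lucas A B k.+1)%:~R = a ^+ k.+1 - b ^+ k.+1 by [].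
elim: k => [|k [IH0 IH1]].
  by rewrite /= mulr0 mulr1 !expr0 subrr.
split=> //; rewrite [lucas _ _ _]/= rmorphB !rmorphM /= mulrBr.
rewrite !(mulrCA (a - b)) IH0 IH1 -Eab -Mab !exprS; ring.
Qed.

(** The hypotheses amount to X + c (X+1)^2 = c (X+a) (X+b). *)
Lemma sum_central_bin (R : comNzRingType) (a b c : R) n :
  a * b = 1 -> c * (a + b) = 2 * c + 1 ->
  \sum_(k < n.+1) c ^+ k *+ ('C(n, k) * 'C(2 * k, k)) =
  c ^+ n * \sum_(k < n.+1) (a ^+ (n - k) * b ^+ k) *+ 'C(n, k) ^ 2.
Proof.
move=> ab1 cab; rewrite -coef_central_shift -coef_central_factored.
rewrite -coefZ -exprZn -!mul_polyC; congr (fun q : {poly R} => (q ^+ n)`_n).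
have /(congr1 polyC) := cab.
rewrite !rmorphM !rmorphD !rmorphM /= !polyC1 => Ecab.
have /(congr1 polyC) := ab1; rewrite rmorphM /= !polyC1 => Eab.
transitivity (c%:P * 'X ^+ 2 + (2%:P * c%:P + 1) * 'X + c%:P * 1).
  by rewrite -[2%:P]/(2%:R)%:P polyC_natr; ring.
by rewrite -Ecab -Eab; ring.
Qed.

(** * Computations with a primitive 12th root of unity *)

Section TwelfthRoot.

Variable z : algC.
Hypothesis prim_z : 12.-primitive_root z.

Local Notation w := (z^-1).
Local Notation s := (z + z^-1).

Let z_neq0 : z != 0.
Proof.
apply: contra_eq_neq (prim_expr_order prim_z) => ->.
by rewrite expr0n eq_sym oner_eq0.
Qed.

Lemma prim12_expr4 : z ^+ 4 = z ^+ 2 - 1.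
Proof.
have z_neq1 k : (0 < k < 12)%N -> z ^+ k != 1.
  move=> /andP[k_gt0 k_lt]; rewrite -(prim_order_dvd prim_z).
  by rewrite gtnNdvd.
(* This factors z^12 - 1; a zero of either of the first two factors would have order dividing 6 or
   4. *)
have /eqP : (z ^+ 6 - 1) * ((z ^+ 2 + 1) * (z ^+ 4 - (z ^+ 2 - 1))) = 0.
  transitivity (z ^+ 12 - 1); first by ring.
  by rewrite (prim_expr_order prim_z) subrr.
rewrite mulf_eq0 subr_eq0 (negPf (z_neq1 6%N _)) //= mulf_eq0 subr_eq0.
case/orP=> [/eqP z2|/eqP //].
have z2N : z ^+ 2 = -1 by rewrite -[RHS]add0r -z2 addrK.
by have := z_neq1 4%N isT; rewrite (exprM z 2 2) z2N sqrrN expr1n eqxx.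
Qed.

Lemma prim12_subV : z - w = z ^+ 3.
Proof.
apply: (mulfI z_neq0); rewrite mulrBr divff // -exprS prim12_expr4; ring.
Qed.

Lemma prim12_addV_sqr : s ^+ 2 = 3.
Proof.
have -> : s ^+ 2 = (z - w) ^+ 2 + 4 * (z * w) by ring.
rewrite divff // prim12_subV -exprM (exprD z 2 4) prim12_expr4.
have -> : z ^+ 2 * (z ^+ 2 - 1) = z ^+ 4 - z ^+ 2 by ring.
by rewrite prim12_expr4; ring.
Qed.

Lemma prim12_expr6 : z ^+ 6 = -1.
Proof.
rewrite (exprD z 2 4) prim12_expr4.
have -> : z ^+ 2 * (z ^+ 2 - 1) = z ^+ 4 - z ^+ 2 by ring.
by rewrite prim12_expr4; ring.
Qed.

Let Aint_z : z \in Aint.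
Proof. exact: Aint_prim_root prim_z. Qed.

Let Aint_w : w \in Aint.
Proof.
have -> : w = z - z ^+ 3 by rewrite -prim12_subV; ring.
by rewrite rpredB ?rpredX.
Qed.

Variable p : nat.
Hypothesis pr_p : prime p.
Hypothesis p_mod12 : (p %% 12 = 1)%N \/ (p %% 12 = 11)%N.

Local Notation n := p.-1.

Let p_gt0 : (0 < p)%N. Proof. exact: prime_gt0. Qed.

Let n_even : ~~ odd n.
Proof. by case: p_mod12; lia. Qed.

(** The cases are p = 1 and p = -1 mod 12; the sign is tied to z^p because the geometric sum below
    needs both. *)
Let expr_p :
  z ^+ p = z /\ (-1) ^+ (n %/ 2) = 1 :> algC \/
  z ^+ p = w /\ (-1) ^+ (n %/ 2) = -1 :> algC.
Proof.
have z12 := prim_expr_order prim_z.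
rewrite -!(prim_expr_mod prim_z p) -!(signr_odd _ (n %/ 2)).
case: p_mod12 => Ep; rewrite Ep; [left|right]; split=> //.
- by have -> : odd (n %/ 2) = false by lia.
- by apply: (mulfI z_neq0); rewrite -exprS z12 divff.
by have -> : odd (n %/ 2) = true by lia.
Qed.

Lemma prim12_central_modp2 :
  (\sum_(k < n.+1) (z ^+ (n - k) * w ^+ k) *+ 'C(n, k) ^ 2 - (-1) ^+ (n %/ 2))
    / p%:R ^+ 2 \in Aint.
Proof.
set e := (-1) ^+ _; have zw_neq0 : z - w != 0 by rewrite prim12_subV expf_neq0.
have sum_bin : \sum_(k < n.+1) z ^+ (n - k) * (- w) ^+ k *+ 'C(n, k) = e.
  rewrite -exprDn prim12_subV.
  have {1}-> : n = (2 * (n %/ 2))%N by case: p_mod12; lia.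
  by rewrite -exprM mulnA exprM prim12_expr6.
have sum_geom : \sum_(k < n.+1) z ^+ (n - k) * w ^+ k = e.
  apply: (mulfI zw_neq0); rewrite -subrXX prednK // exprVn.
  case: expr_p => -[-> ee]; rewrite /e ee ?invrK; ring.
(* Both sums equal e, so e = 2 e - e can be distributed over the terms and compared with C(n,k)^2
   one k at a time. *)
have -> : e = \sum_(k < n.+1)
    z ^+ (n - k) * w ^+ k * (2 * (-1) ^+ k * 'C(n, k)%:R - 1).
  transitivity (2 * e - e); first by ring.
  rewrite -{1}sum_bin -sum_geom mulr_sumr -sumrB; apply: eq_bigr => k _.
  rewrite [(- w) ^+ k]exprNn -[_ *+ _]mulr_natr; ring.
rewrite -sumrB mulr_suml rpred_sum // => k _.
rewrite -[_ *+ _]mulr_natr -mulrBr -(mulrA _ _ (p%:R ^+ 2)^-1).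
apply: rpredM; first by rewrite rpredM ?rpredX.
have lt_kp : (k < p)%N by rewrite -[X in (_ < X)%N](prednK p_gt0).
have /Aint_dvdz := prime_dvd_bin_pred_sqr pr_p lt_kp.
rewrite expf_eq0 /= eqz_nat -lt0n p_gt0 => /(_ isT).
by rewrite !(rmorphB, rmorphM, rmorphXn, rmorphN, rmorph1) /=.
Qed.

(** Frobenius is applied to 2 + (x + y), x + y and 1 + 1. Taking (x, y) = (z, w) and (-z, -w) covers
    both 2 + s and 2 - s. *)
Let Aint_pow_sub x y : x \in Aint -> y \in Aint -> x ^+ p + y ^+ p = x + y ->
  ((2 + (x + y)) ^+ p - (2 + (x + y))) / p%:R \in Aint.
Proof.
move=> Ax Ay Exy.
have A1 := rpred1 Aint; have A2 : 2 \in Aint by rewrite rpred_nat.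
have F1 := Frobenius_Aint pr_p A2 (rpredD Ax Ay).
have F2 := Frobenius_Aint pr_p Ax Ay.
have F3 := Frobenius_Aint pr_p A1 A1.
have := rpredD (rpredD F1 F2) F3; rewrite -!mulrDl Exy !expr1n.
by rewrite -[1 + 1]/(2 : algC); congr (_ / _ \in Aint); ring.
Qed.

Let binet_add : (2 + s) + (2 - s) = (4 : int)%:~R.
Proof. by rewrite -[RHS]/(4 : algC); ring. Qed.

Let binet_mul : (2 + s) * (2 - s) = (1 : int)%:~R.
Proof.
have -> : (2 + s) * (2 - s) = 4 - s ^+ 2 by ring.
by rewrite prim12_addV_sqr; ring.
Qed.

Lemma prime_dvd_lucas41 : (p%:Z %| lucas 4 1 n)%Z.
Proof.
have p_neq0 : p%:Z != 0 by rewrite eqz_nat -lt0n.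
have Ep : z ^+ p + w ^+ p = s.
  rewrite exprVn; case: expr_p => -[-> _] //.
  by rewrite invrK addrC.
have p_odd : odd p by case: p_mod12; lia.
have ENp : (- z) ^+ p + (- w) ^+ p = - z + - w.
  by rewrite (exprNn z) (exprNn w) -signr_odd p_odd !mulN1r -!opprD Ep.
have Aa := Aint_pow_sub Aint_z Aint_w Ep.
have Ab := Aint_pow_sub (rpredNr Aint_z) (rpredNr Aint_w) ENp.
rewrite -opprD in Ab.
have As : s \in Aint by rewrite rpredD.
have A2 : 2 \in Aint by rewrite rpred_nat.
(* Binet yields 2 s u_n; a further factor s makes it the integer 2 s^2 u_n = 6 u_n, and 6 is prime
   to p. *)
have: (p%:Z %| 6 * lucas 4 1 n)%Z.
  apply: dvdz_Aint => //.
  have -> : (6 * lucas 4 1 n)%:~R / p%:~R =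
      s * ((2 - s) * (((2 + s) ^+ p - (2 + s)) / p%:R) -
           (2 + s) * (((2 - s) ^+ p - (2 - s)) / p%:R)) :> algC.
    rewrite !(mulrA _ _ p%:R^-1) -mulrBl mulrA; congr (_ / _).
    (* As the roots are mutually inverse, multiplying by one divides by the other without leaving
       [Aint]. *)
    have red x y : x * y = 1 -> y * (x ^+ p - x) = x ^+ n - 1 :> algC.
      move=> xy; rewrite -(prednK p_gt0) exprS /=.
      by rewrite mulrBr mulrA (mulrC y x) xy mul1r.
    rewrite (red _ _ binet_mul) (red _ _ (etrans (mulrC _ _) binet_mul)).
    have -> (a b : algC) : a - 1 - (b - 1) = a - b by ring.
    rewrite -(lucas_Binet _ binet_add binet_mul) rmorphM /= -[6%:~R]/(6 : algC).
    transitivity (2 * s ^+ 2 * (lucas 4 1 n)%:~R : algC); last by ring.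
    by rewrite prim12_addV_sqr; ring.
  by apply: rpredM => //; apply: rpredB; apply: rpredM => //;
    rewrite ?rpredB ?(rpredD A2).
have cop6 : coprime p 6.
  apply: (@coprime_dvdr _ 12) => //.
  by rewrite -coprime_modl; case: p_mod12 => ->.
by rewrite Gauss_dvdzr.
Qed.

Lemma sum_central_lucas41 :
  (\sum_(0 <= k < p)
      'C(n, k)%:Z * 'C(2 * k, k)%:Z * (-1) ^+ k * lucas 4 1 k)%:~R =
  (lucas 4 1 n)%:~R *
    \sum_(k < n.+1) (z ^+ (n - k) * w ^+ k) *+ 'C(n, k) ^ 2 :> algC.
Proof.
set T := \sum_(_ < _) _; pose a := 2 + s; pose b := 2 - s.
have s_neq0 : s != 0.
  apply: contra_eq_neq prim12_addV_sqr => ->.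
  by rewrite expr0n eq_sym pnatr_eq0.
have ab_neq0 : a - b != 0.
  have -> : a - b = 2 * s by rewrite /a /b; ring.
  by rewrite mulf_neq0 ?pnatr_eq0.
have zw : z * w = 1 by rewrite divff.
have s2 := prim12_addV_sqr.
have Ea : (- a) * s = 2 * (- a) + 1.
  transitivity (- 2 * s - s ^+ 2); first by rewrite /a; ring.
  by rewrite s2 /a; ring.
have Eb : (- b) * (- z + - w) = 2 * (- b) + 1.
  transitivity (2 * s - s ^+ 2); first by rewrite /b; ring.
  by rewrite s2 /b; ring.
have Ta := sum_central_bin n zw Ea.
have Tb := sum_central_bin n (etrans (mulrNN _ _) zw) Eb.
(* The signs combine to (-1)^n = 1. *)
have ET : \sum_(k < n.+1) ((- z) ^+ (n - k) * (- w) ^+ k) *+ 'C(n, k) ^ 2 = T.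
  apply: eq_bigr => -[k /= le_kn] _; congr (_ *+ _).
  by rewrite (exprNn z) (exprNn w) mulrACA -exprD subnK // -signr_odd
    (negPf n_even) mul1r.
have negX x : (- x) ^+ n = x ^+ n :> algC.
  by rewrite exprNn -signr_odd (negPf n_even) mul1r.
rewrite !negX -/T ?ET in Ta Tb.
(* After multiplication by a - b, Binet turns each (-1)^k u_k into (-a)^k - (-b)^k, so the sum is
   the difference of [Ta] and [Tb]. *)
apply: (mulfI ab_neq0); rewrite [RHS]mulrA (lucas_Binet _ binet_add binet_mul).
rewrite -/a -/b [RHS]mulrBl -Ta -Tb big_mkord rmorph_sum /=.
rewrite mulr_sumr prednK // -sumrB.
apply: eq_bigr => k _; rewrite !rmorphM rmorphXn rmorphN rmorph1 /=.
rewrite mulrCA (lucas_Binet _ binet_add binet_mul) -/a -/b.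
rewrite -[(- a) ^+ k *+ _]mulr_natr -[(- b) ^+ k *+ _]mulr_natr natrM.
by rewrite (exprNn a) (exprNn b) -!pmulrn; ring.
Qed.

End TwelfthRoot.

Theorem theorem1p2 (p : nat) (p_prime : prime p)
    (p_mod12 : (p%:Z = 1 %[mod 12])%Z \/ (p%:Z = -1 %[mod 12])%Z) :
  (\sum_(0 <= k < p)
      'C(p.-1, k)%:Z * 'C(2 * k, k)%:Z * (-1) ^+ k * lucas 4 1 k
   = (-1) ^+ (p.-1 %/ 2) * lucas 4 1 p.-1 %[mod p%:Z ^+ 3])%Z.
Proof.
have {}p_mod12 : (p %% 12 = 1)%N \/ (p %% 12 = 11)%N by case: p_mod12; lia.
have p_neq0 : p%:Z != 0 by rewrite eqz_nat -lt0n prime_gt0.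
have [z prim_z] := C_prim_root_exists (isT : (0 < 12)%N).
apply/eqP; rewrite eqz_mod_dvd; apply: dvdz_Aint; first by rewrite expf_neq0.
rewrite rmorphB /= (sum_central_lucas41 prim_z) //.
have Au := Aint_dvdz p_neq0 (prime_dvd_lucas41 prim_z p_prime p_mod12).
(* The factor p of u_n and the factor p^2 of T - (-1)^(n/2) multiply to p^3. *)
have := rpredM Au (prim12_central_modp2 prim_z p_prime p_mod12).
rewrite rmorphM !rmorphXn rmorphN rmorph1 /= mulrACA -invfM -exprS.
by rewrite mulrBr [_ * (-1) ^+ _]mulrC.
Qed.
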